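(* Let $\mathbb{D}$ be a class of filters and let $\xi$ be a pseudotopology on a set $X$. Then for every $x\in X$, $$\mathbb{U}_{\mathrm{A}_{\mathbb{D}}\xi}(x)=\mathrm{cl}_{\mathbb{D}^{*}}\left(\mathbb{U}_{\xi}(x)\right).$$
   Context: Filters on $X$ are families of nonempty subsets closed under finite intersections and supersets. A class $\mathbb{D}$ of filters assigns to each set $X$ a set $\mathbb{D}X$ of filters on $X$. Two families of sets mesh, $\mathcal{A}\#\mathcal{B}$, if $A\cap B\neq\emptyset$ for all $A\in\mathcal{A},B\in\mathcal{B}$. A convergence $\xi$ on $X$ is a relation between points and filters, written $x\in\lim_\xi\mathcal{F}$, such that $x\in\lim_\xi\{x\}^{\uparrow}$ for all $x$ (where $\{x\}^\uparrow$ is the principal ultrafilter of $x$), and $\mathcal{F}\subset\mathcal{G}$ implies $\lim_\xi\mathcal{F}\subset\lim_\xi\mathcal{G}$. The adherence of a filter $\mathcal{H}$ is $\mathrm{adh}_\xi\mathcal{H}=\bigcup_{\mathcal{F}\#\mathcal{H}}\lim_\xi\mathcal{F}$ (union over filters $\mathcal{F}$ on $X$). $\xi$ is a pseudotopology if $\lim_\xi\mathcal{F}=\bigcap\{\lim_\xi\mathcal{U}:\mathcal{U}\supset\mathcal{F}\text{ an ultrafilter}\}$ for every filter $\mathcal{F}$. $\mathrm{A}_{\mathbb{D}}\xi$ is the convergence on $X$ with $\lim_{\mathrm{A}_{\mathbb{D}}\xi}\mathcal{F}=\bigcap\{\mathrm{adh}_\xi\mathcal{D}:\mathcal{D}\in\mathbb{D}X,\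 \mathcal{D}\#\mathcal{F}\}$. $\mathbb{U}X$ is the set of all ultrafilters on $X$; for a convergence $\theta$ on $X$, $\mathbb{U}_\theta(x)=\{\mathcal{U}\in\mathbb{U}X:x\in\lim_\theta\mathcal{U}\}$. For a filter $\mathcal{D}$, $\beta\mathcal{D}=\{\mathcal{U}\in\mathbb{U}X:\mathcal{D}\subset\mathcal{U}\}$. For $A\subset\mathbb{U}X$, $$\mathrm{cl}_{\mathbb{D}^*}A=\bigcap\{\mathbb{U}X\setminus\beta\mathcal{D}:\mathcal{D}\in\mathbb{D}X,\ A\subset\mathbb{U}X\setminus\beta\mathcal{D}\}$$ (an empty intersection being $\mathbb{U}X$). *)

(* Defs.v *)
From mathcomp Require Import all_boot.
From mathcomp Require Import boolp classical_sets filter.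

Set Implicit Arguments.
Unset Strict Implicit.
Unset Printing Implicit Defensive.

Local Open Scope classical_set_scope.

(* [pfilter_on X] is the type of proper filters on X (packed with the proof of
   properness), so that everything below quantifies over genuine filters.  No
   closure condition relates the values at different X. *)
Definition class_of_filters := forall X : Type, set (pfilter_on X).

Definition point_filter (X : Type) (x : X) : pfilter_on X :=
  PFilterPack (principal_filter x) (principal_filter_proper x).

Record convergence (X : Type) := Convergence {
  clim : pfilter_on X -> set X ;
  clim_point : forall x : X, clim (point_filter x) x ;
  clim_mono : forall F G : pfilter_on X, F `<=` G -> clim F `<=` clim G
}.

Definition adherence (X : Type) (xi : convergence X) (H : pfilter_on X) :
    set X :=
  \bigcup_(F in [set F : pfilter_on X | F `#` H]) clim xi F.

Definition ultrafilters (X : Type) : set (pfilter_on X) :=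
  [set U : pfilter_on X | UltraFilter U].

Definition beta (X : Type) (D : pfilter_on X) : set (pfilter_on X) :=
  [set U | ultrafilters U /\ D `<=` U].

Definition pseudotopology (X : Type) (xi : convergence X) : Prop :=
  forall F : pfilter_on X, clim xi F = \bigcap_(U in beta F) clim xi U.

Definition adh_clim (DD : class_of_filters) (X : Type) (xi : convergence X)
    (F : pfilter_on X) : set X :=
  \bigcap_(D in [set D : pfilter_on X | DD X D /\ D `#` F]) adherence xi D.

Lemma adh_clim_point (DD : class_of_filters) (X : Type) (xi : convergence X)
  (x : X) : adh_clim DD xi (point_filter x) x.
Proof.
move=> D [_ Dx]; exists (point_filter x); last exact: clim_point.
by rewrite /= meetsC.
Qed.

Lemma adh_clim_mono (DD : class_of_filters) (X : Type) (xi : convergence X)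
  (F G : pfilter_on X) : F `<=` G -> adh_clim DD xi F `<=` adh_clim DD xi G.
Proof.
move=> FG x Fx D [DD_D DG]; apply: Fx; split=> // A B DA FB.
exact: DG DA (FG _ FB).
Qed.

(* The modification A_D xi. *)
Definition adh_mod (DD : class_of_filters) (X : Type) (xi : convergence X) :
    convergence X :=
  Convergence (@adh_clim_point DD X xi) (@adh_clim_mono DD X xi).

Definition Ulim (X : Type) (theta : convergence X) (x : X) :
    set (pfilter_on X) :=
  [set U | ultrafilters U /\ clim theta U x].

(* Subsets of the set of ultrafilters are encoded as sets of proper filters
   contained in [ultrafilters X]; intersecting with the latter makes the empty
   intersection equal to the set of all ultrafilters. *)
Definition cl_star (DD : class_of_filters) (X : Type) (A : set (pfilter_on X)) :
    set (pfilter_on X) :=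
  @ultrafilters X `&`
  \bigcap_(D in [set D | DD X D /\ A `<=` @ultrafilters X `\` beta D])
    (@ultrafilters X `\` beta D).

(* Main.v *)
(* An ultrafilter meshes with a filter D exactly when it contains D, and
   adh_xi D is the set of xi-limits of the ultrafilters containing D.  Hence
   an ultrafilter U belongs to either side iff every D in DD contained in U
   is contained in some ultrafilter converging to x. *)
From mathcomp Require Import all_boot.
From mathcomp Require Import boolp classical_sets filter.
Require Import Defs.

Set Implicit Arguments.
Unset Strict Implicit.
Unset Printing Implicit Defensive.

Local Open Scope classical_set_scope.

(** If some [A] in [D] were not in [U], its complement would be in [U] and miss [A]; conversely,
    members of [U] pairwise intersect. *)
Lemma ultra_meetsE (X : Type) (D : pfilter_on X) (U : set_system X) :
  UltraFilter U -> (D `#` U) = (D `<=` U).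
Proof.
move=> UU; rewrite propeqE; split=> [DU A DA|DU].
  have [//|UcA] := in_ultra_setVsetC A UU.
  by have [y []] := DU _ _ DA UcA.
exact: sub_meets DU (@subset_refl _ U) (proper_meetsxx _).
Qed.

(** By meshing, the intersections of a member of [F] with one of [G] form a base of a proper filter,
    which extends to an ultrafilter. *)
Lemma meets_ultra (X : Type) (F G : pfilter_on X) : F `#` G ->
  exists U : pfilter_on X, [/\ ultrafilters U, F `<=` U & G `<=` U].
Proof.
move=> FG.
pose J := filter_from [set AB : set X * set X | F AB.1 /\ G AB.2]
                      (fun AB => AB.1 `&` AB.2).
have JP : ProperFilter J.
  apply: filter_from_proper => [|[A B] [/= FA GB]]; last exact: FG.
  apply: filter_from_filter.
    by exists (setT, setT); split; exact: filterT.
  move=> [A B] [A' B'] [/= FA GB] [/= FA' GB'].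
  exists (A `&` A', B `&` B'); first by split; exact: filterI.
  by rewrite /= setIACA.
have [U [UU JU]] := ultraFilterLemma JP.
exists (PFilterPack U ultra_proper); split=> // A HA; apply: JU.
  by exists (A, setT); [split=> //; exact: filterT | exact: subIsetl].
by exists (setT, A); [split=> //; exact: filterT | exact: subIsetr].
Qed.

(** A common ultrafilter refinement of [D] and a filter meshing with it keeps the limits of the
    latter. *)
Lemma adherence_ultraE (X : Type) (xi : convergence X) (D : pfilter_on X) :
  adherence xi D = \bigcup_(U in beta D) clim xi U.
Proof.
rewrite eqEsubset; split=> y [F].
  move=> /meets_ultra[U [UU FU DU]] Fy.
  by exists U => //; exact: clim_mono FU _ Fy.
move=> [UF DF] Fy; exists F => //=.
by rewrite meetsC (ultra_meetsE _ UF).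
Qed.

Theorem theorem25 (DD : class_of_filters) (X : Type) (xi : convergence X)
  (hxi : pseudotopology xi) (x : X) :
  Ulim (adh_mod DD xi) x = cl_star DD (Ulim xi x).
Proof.
rewrite eqEsubset; split=> U [UU Ux]; split=> // D [DD_D].
  move=> AD; split=> // -[_ DU].
  (* This yields an ultrafilter [V] containing [D] and converging to [x], which [AD] forbids. *)
  have : adherence xi D x by apply: Ux; split=> //; rewrite (ultra_meetsE _ UU).
  rewrite adherence_ultraE => -[V bV Vx].
  by have [] := AD V (conj bV.1 Vx).
rewrite (ultra_meetsE _ UU) => DU; rewrite adherence_ultraE.
(* If no ultrafilter containing [D] converged to [x], then [D] would be an index of the intersection
   defining the closure, so [U] could not contain [D]. *)
apply: contrapT => nadh.
suff /(Ux D)[_] : [set D | DD X D /\ Ulim xi x `<=` @ultrafilters X `\` beta D] D.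
  by apply; split.
split=> // V [UV Vx]; split=> // bV.
by apply: nadh; exists V.
Qed.
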